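(* Let $\{\mathcal G_k\}_{k=1}^\infty$ be a wide sequence and let $F$ be a family of random variables on $\mathcal G_n$ which contains all constant functions. Let $\varphi(x_0,\dots,x_{l-1})$ be an open (quantifier-free) $\{E\}$-formula and let $p\in[0,1]$. Assume that $$\lim_{k\to\infty}\Pr_{\omega\in\mathcal G_k,\ \overline a}\big[\omega\models\varphi(\overline a)\big]\ge p,$$ where $\omega$ is sampled uniformly from $\mathcal G_k$ and $\overline a$ is sampled uniformly from $\{0,\dots,k-1\}^l$. Then $$\mu\big(\lim_F\mathcal G_n[\![(\exists\overline x)\varphi(\overline x)]\!]\big)\ge p.$$ In particular, if $p=1$ then $\lim_F\mathcal G_n[\![(\exists\overline x)\varphi(\overline x)]\!]=\mathbf 1$.
   Context: Setup. $L_{all}$ is the first-order language with a name for every relation and function on $\mathbb N$. Fix an $\aleph_1$-saturated nonstandard model $\mathcal M$ of the true theory $\mathrm{Th}_{L_{all}}(\mathbb N)$, with $\mathbb N\subseteq\mathcal M$ as an initial segment, and a nonstandard number $n\in\mathcal M\setminus\mathbb N$. Finite sets, functions and sequences are coded by numbers; for a set $S$ coded in $\mathcal M$, $|S|\in\mathcal M$ is its (possibly nonstandard) cardinality. Any sequence of standard finite objects $\{a_k\}_k$ is given by a function symbol of $L_{all}$ and hence has a value $a_n\in\mathcal M$ at the nonstandard index $n$. $\mathbb Q^{\mathcal M}$ is the ordered field of fractions of elements of $\mathcal M$ and their negatives; $\mathrm{st}(q)\in\mathbb R$ is the standard part of a finite $q\in\mathbb Q^{\mathcal M}$; $q$ is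 infinitesimal if $|q|<1/k$ for all standard $k\ge1$. Wide sequence. A sequence $\{\mathcal G_k\}_{k=1}^\infty$ of finite sets of graphs (structures with one antireflexive symmetric binary relation $E$) such that every $\omega\in\mathcal G_k$ has vertex set $\{0,\dots,k-1\}$ and $\lim_{k\to\infty}|\mathcal G_k|=\infty$. $\mathcal G_n$ is the value of the sequence at index $n$; for $\omega\in\mathcal G_n$, $E_\omega$ is its edge relation. Boolean algebra. $\mathcal A$ is the Boolean algebra of all subsets of $\mathcal G_n$ coded by an element of $\mathcal M$; $\mathcal I$ is the ideal of those $A\in\mathcal A$ with $|A|/|\mathcal G_n|$ infinitesimal; $\mathcal B=\mathcal A/\mathcal I$. $\mathcal B$ is a complete Boolean algebra with greatest element $\mathbf 1$, least element $\mathbf 0$, and measure $\mu(A/\mathcal I)=\mathrm{st}(|A|/|\mathcal G_n|)$. Family of random variables. A set $F$ of functions $\alpha:\mathcal G_n\to\mathcal M$, each coded by an element of $\mathcal M$. An $F$-vertex is an $\alpha\in F$ with $\alpha(\omega)\in\{0,\dots,n-1\}$ for all $\omega\in\mathcal G_n$; $U(F)$ is the set of $F$-vertices. Wide limit. $\lim_F\mathcal G_n$ is the $\mathcal B$-valued $\{E\}$-structure with universe $U(F)$ and truth values $[\![\alpha=\beta]\!]=\{\omega\in\mathcal G_n:\alpha(\omega)=\beta(\omega)\}/\mathcal I$, $[\![E(\alpha,\beta)]\!]=\{\omega\in\mathcal G_n:E_\omega(\alpha(\omega),\beta(\omega))\}/\mathcal I$; $[\![-]\!]$ commutes with $\neg,\wedge,\vee$;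 $[\![(\exists x)A(x)]\!]=\bigvee_{\alpha\in U(F)}[\![A(\alpha)]\!]$ and $[\![(\forall x)A(x)]\!]=\bigwedge_{\alpha\in U(F)}[\![A(\alpha)]\!]$. *)

(* Defs.v *)
From HB Require Import structures.
From mathcomp Require Import all_boot all_order all_algebra generic_quotient finmap.
From mathcomp Require Import all_classical reals topology normedtype sequences.
From mathcomp Require Import zify ring lra.
Set Implicit Arguments.
Unset Strict Implicit.
Unset Printing Implicit Defensive.

Import Order.TTheory GRing.Theory Num.Theory.

Local Open Scope quotient_scope.
Local Open Scope classical_set_scope.

Definition vext (T : Type) (l : nat) (v : 'I_l -> T) (x : T) (i : 'I_l.+1) : T :=
  if unlift ord_max i is Some j then v j else x.

Definition vnil (T : Type) (i : 'I_0) : T := False_rect T (notF (ltn_ord i)).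

(* The language L_all: its k-ary function (relation) symbols are all the
   functions (relations) of arity k on nat.  The free variables of a formula of
   type [form l] are among x_0, ..., x_(l-1), and [Ex], [All] bind the last
   variable x_l of their argument. *)
Inductive term (l : nat) : Type :=
| Var of 'I_l
| App (k : nat) of ('I_k -> nat) -> nat & 'I_k -> term l.

Inductive form (l : nat) : Type :=
| Eq of term l & term l
| Rel (k : nat) of ('I_k -> nat) -> Prop & 'I_k -> term l
| Neg of form l
| And of form l & form l
| Or of form l & form l
| Imp of form l & form l
| Ex of form l.+1
| All of form l.+1.

Record structure := Structure {
  carrier :> Type;
  funI : forall k, (('I_k -> nat) -> nat) -> ('I_k -> carrier) -> carrier;
  relI : forall k, (('I_k -> nat) -> Prop) -> ('I_k -> carrier) -> Prop }.

Fixpoint eval (M : structure) l (v : 'I_l -> M) (t : term l) : M :=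
  match t with
  | Var i => v i
  | App k f ts => funI f (fun i => eval v (ts i))
  end.

Fixpoint sat (M : structure) l (phi : form l) : ('I_l -> M) -> Prop :=
  match phi with
  | Eq t u => fun v => eval v t = eval v u
  | Rel k r ts => fun v => relI r (fun i => eval v (ts i))
  | Neg a => fun v => ~ sat a v
  | And a b => fun v => sat a v /\ sat b v
  | Or a b => fun v => sat a v \/ sat b v
  | Imp a b => fun v => sat a v -> sat b v
  | Ex a => fun v => exists x : M, sat a (vext v x)
  | All a => fun v => forall x : M, sat a (vext v x)
  end.

Definition holds (M : structure) (sigma : form 0) : Prop := sat sigma (@vnil M).

Definition stdN : structure :=
  @Structure nat (fun k f => f) (fun k r => r).

Record true_model := TrueModel {
  model :> structure;
  model_true : forall sigma : form 0, holds stdN sigma -> holds model sigma }.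

(* A formula in one variable x with parameters from M; x is the last variable
   of the matrix. *)
Record pform (M : structure) := PForm {
  pnum : nat;
  pmatrix : form pnum.+1;
  param : 'I_pnum -> M }.

Definition psat (M : structure) (psi : pform M) (x : M) : Prop :=
  sat (pmatrix psi) (vext (@param M psi) x).

Definition aleph1_saturated (M : structure) : Prop :=
  forall (A : set M) (Gamma : set (pform M)),
    countable A ->
    (forall psi, Gamma psi -> forall i, A (@param M psi i)) ->
    (forall D, D `<=` Gamma -> finite_set D ->
       exists x, forall psi, D psi -> psat psi x) ->
    exists x, forall psi, Gamma psi -> psat psi x.

(* A fixed coding of finite sets of numbers; a number that is not the code of a
   finite set is read as a code of the empty set. *)
Definition fset_code (A : {fset nat}) : nat := choice.pickle A.
Definition fset_decode (s : nat) : {fset nat} :=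
  odflt fset0 (choice.unpickle s).

Lemma fset_codeK : cancel fset_code fset_decode.
Proof. by move=> A; rewrite /fset_decode /fset_code choice.pickleK. Qed.

Definition pair_code (x y : nat) : nat := choice.pickle (x, y).

Lemma pair_code_inj x y x' y' :
  pair_code x y = pair_code x' y' -> x = x' /\ y = y'.
Proof. by move=> /(pcan_inj choice.pickleK) [-> ->]. Qed.

Section Interpretations.
Variable M : structure.

Definition std (k : nat) : M := funI (fun _ : 'I_0 -> nat => k) (@vnil M).

Definition fun1 (f : nat -> nat) (x : M) : M :=
  funI (fun a : 'I_1 -> nat => f (a ord0)) (fun _ => x).
Definition fun2 (f : nat -> nat -> nat) (x y : M) : M :=
  funI (fun a : 'I_2 -> nat => f (a ord0) (a ord_max)) (tnth [tuple x; y]).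
Definition rel2 (r : nat -> nat -> Prop) (x y : M) : Prop :=
  relI (fun a : 'I_2 -> nat => r (a ord0) (a ord_max)) (tnth [tuple x; y]).

Definition addM := fun2 addn.
Definition mulM := fun2 muln.
Definition leM := rel2 (fun x y => x <= y).
Definition ltM := rel2 (fun x y => x < y).
Definition pairM := fun2 pair_code.
Definition memM := rel2 (fun x s => x \in fset_decode s).
Definition cardM := fun1 (fun s => #|` fset_decode s|%fset).

Definition nonstandard (x : M) : Prop := forall k, x <> std k.

End Interpretations.

Section Transfer.

Fixpoint alls l : form l -> form 0 :=
  if l is l'.+1 then fun phi => alls (All phi) else fun phi => phi.

Lemma vext_restr (T : Type) l (v : 'I_l.+1 -> T) :
  vext (fun i => v (lift ord_max i)) (v ord_max) = v.
Proof.
apply: funext => i; rewrite /vext; case: (unliftP ord_max i) => [j|] -> //=.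
Qed.

Lemma sat_alls (M : structure) l (phi : form l) :
  holds M (alls phi) <-> forall v : 'I_l -> M, sat phi v.
Proof.
elim: l phi => [|l IH] phi /=.
  split=> [h v|]; last exact.
  by rewrite (_ : v = @vnil M) //; apply: funext => -[].
split=> [/IH h v|h]; first by rewrite -(vext_restr v); exact: h.
by apply/IH => v x; exact: h.
Qed.

Lemma transfer (M : true_model) l (phi : form l) :
  (forall v, @sat stdN l phi v) -> forall v, @sat M l phi v.
Proof. by move=> h; apply/sat_alls/model_true/sat_alls. Qed.

Definition Cst l (k : nat) : term l :=
  App (fun _ : 'I_0 -> nat => k) (@vnil (term l)).
Definition App1 l (f : nat -> nat) (t : term l) : term l :=
  App (fun a : 'I_1 -> nat => f (a ord0)) (fun _ => t).
Definition App2 l (f : nat -> nat -> nat) (t u : term l) : term l :=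
  App (fun a : 'I_2 -> nat => f (a ord0) (a ord_max)) (tnth [tuple t; u]).
Definition Rel2 l (r : nat -> nat -> Prop) (t u : term l) : form l :=
  Rel (fun a : 'I_2 -> nat => r (a ord0) (a ord_max)) (tnth [tuple t; u]).

Lemma tnth2_comp (S T : Type) (g : S -> T) (x y : S) :
  (fun i => g (tnth [tuple x; y] i)) = tnth [tuple g x; g y].
Proof. by apply: funext => -[[|[]]]. Qed.

Lemma eval_Cst (M : structure) l (v : 'I_l -> M) k : eval v (Cst l k) = std M k.
Proof. by rewrite /=; congr funI; apply: funext => -[]. Qed.
Lemma eval_App1 (M : structure) l (v : 'I_l -> M) f t :
  eval v (App1 f t) = fun1 f (eval v t).
Proof. by []. Qed.
Lemma eval_App2 (M : structure) l (v : 'I_l -> M) f t u :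
  eval v (App2 f t u) = fun2 f (eval v t) (eval v u).
Proof. by rewrite /= (tnth2_comp (eval v)). Qed.
Lemma sat_Rel2 (M : structure) l (v : 'I_l -> M) r t u :
  sat (Rel2 r t u) v = rel2 r (eval v t) (eval v u).
Proof. by rewrite /= (tnth2_comp (eval v)). Qed.

Lemma fun1N f (x : stdN) : fun1 f x = f x. Proof. by []. Qed.
Lemma fun2N f (x y : stdN) : fun2 f x y = f x y. Proof. by []. Qed.
Lemma rel2N r (x y : stdN) : rel2 r x y = r x y. Proof. by []. Qed.
Lemma stdNE k : std stdN k = k. Proof. by []. Qed.

Lemma sat_Imp (M : structure) l (v : 'I_l -> M) a b :
  sat (Imp a b) v = (sat a v -> sat b v).
Proof. by []. Qed.
Lemma sat_And (M : structure) l (v : 'I_l -> M) a b :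
  sat (And a b) v = (sat a v /\ sat b v).
Proof. by []. Qed.
Lemma sat_Or (M : structure) l (v : 'I_l -> M) a b :
  sat (Or a b) v = (sat a v \/ sat b v).
Proof. by []. Qed.
Lemma sat_Neg (M : structure) l (v : 'I_l -> M) a :
  sat (Neg a) v = (~ sat a v).
Proof. by []. Qed.
Lemma sat_Eq (M : structure) l (v : 'I_l -> M) t u :
  sat (Eq t u) v = (eval v t = eval v u).
Proof. by []. Qed.

(* The variable x_i; the index is clipped only to make it an ordinal. *)
Definition X l (i : nat) : term l.+1 :=
  Var (Ordinal (geq_minr i l : minn i l < l.+1)).
Lemma eval_X (M : structure) l (v : 'I_l.+1 -> M) i :
  eval v (X l i) = v (Ordinal (geq_minr i l : minn i l < l.+1)).
Proof. by []. Qed.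

Definition satE := (sat_Imp, sat_And, sat_Or, sat_Neg, sat_Eq, sat_Rel2,
  eval_Cst, eval_App1, eval_App2, eval_X, fun1N, fun2N, rel2N, stdNE).

End Transfer.
Arguments X {l} i.


Section ModelFacts.
Variable M : true_model.
Implicit Types (a b c g x y z : M).

Lemma std_neq0 k : std M k.+1 <> std M 0.
Proof.
have := @transfer M 0 (Neg (Eq (Cst 0 k.+1) (Cst 0 0))) _ (@vnil M).
by rewrite !satE; apply=> v; rewrite !satE.
Qed.

Definition cup_code s t := fset_code (fset_decode s `|` fset_decode t)%fset.
Definition dif_code s t := fset_code (fset_decode s `\` fset_decode t)%fset.
Definition wit_code s t := head 0 (fset_decode s `\` fset_decode t)%fset.

Lemma mem_cup x a b : memM x (fun2 cup_code a b) <-> memM x a \/ memM x b.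
Proof.
pose m (x s : nat) := x \in fset_decode s.
have := @transfer M 3 (And
 (Imp (Rel2 m (X 0) (App2 cup_code (X 1) (X 2)))
   (Or (Rel2 m (X 0) (X 1)) (Rel2 m (X 0) (X 2))))
 (Imp (Or (Rel2 m (X 0) (X 1)) (Rel2 m (X 0) (X 2)))
   (Rel2 m (X 0) (App2 cup_code (X 1) (X 2))))) _ (tnth [tuple x; a; b]).
rewrite !satE; apply=> v; rewrite !satE /m fset_codeK in_fsetU.
by split=> [/orP|h]; last exact/orP.
Qed.

Lemma mem_dif x a b : memM x (fun2 dif_code a b) <-> memM x a /\ ~ memM x b.
Proof.
pose m (x s : nat) := x \in fset_decode s.
have := @transfer M 3 (And
 (Imp (Rel2 m (X 0) (App2 dif_code (X 1) (X 2)))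
   (And (Rel2 m (X 0) (X 1)) (Neg (Rel2 m (X 0) (X 2)))))
 (Imp (And (Rel2 m (X 0) (X 1)) (Neg (Rel2 m (X 0) (X 2))))
   (Rel2 m (X 0) (App2 dif_code (X 1) (X 2))))) _ (tnth [tuple x; a; b]).
rewrite !satE; apply=> v; rewrite !satE /m fset_codeK in_fsetD.
by split=> [/andP[/negP]|[? /negP]] // => *; exact/andP.
Qed.

Lemma le_cardM a b : (forall x, memM x a -> memM x b) ->
  leM (cardM a) (cardM b).
Proof.
pose m (x s : nat) := x \in fset_decode s.
pose cd (s : nat) := #|` fset_decode s|%fset.
have := @transfer M 2 (Imp
  (Imp (Rel2 m (App2 wit_code (X 0) (X 1)) (X 0))
       (Rel2 m (App2 wit_code (X 0) (X 1)) (X 1)))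
  (Rel2 (fun x y : nat => x <= y) (App1 cd (X 0)) (App1 cd (X 1)))) _
  (tnth [tuple a; b]).
rewrite !satE => h sab; apply: h; last exact: sab.
move=> v; rewrite !satE /m /cd /wit_code.
set A := fset_decode _; set B := fset_decode _ => h.
apply: fsubset_leq_card; rewrite -fsetD_eq0.
case E: (enum_fset (A `\` B)%fset) h => [|x s] /=.
  by move=> _; apply/eqP/fsetP => y; rewrite (_ : (y \in A `\` B)%fset = (y \in enum_fset (A `\` B)%fset)) // E.
have : (x \in A `\` B)%fset.
  by rewrite (_ : (x \in A `\` B)%fset = (x \in enum_fset (A `\` B)%fset)) // E mem_head.
by rewrite in_fsetD => /andP[/negP xB xA] /(_ xA).
Qed.

Lemma card_cup a b :
  leM (cardM (fun2 cup_code a b)) (addM (cardM a) (cardM b)).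
Proof.
pose cd (s : nat) := #|` fset_decode s|%fset.
have := @transfer M 2
  (Rel2 (fun x y : nat => x <= y) (App1 cd (App2 cup_code (X 0) (X 1)))
    (App2 addn (App1 cd (X 0)) (App1 cd (X 1)))) _ (tnth [tuple a; b]).
rewrite !satE; apply => v; rewrite !satE /cd fset_codeK.
by rewrite -cardfsUI leq_addr.
Qed.

End ModelFacts.

Section Fractions.
Variable M : true_model.

(* Q^M as formal fractions (qpos - qneg) / qden; only its order is needed. *)
Record fracM := FracM {
  qpos : M; qneg : M; qden : M; qden_neq0 : qden <> std M 0 }.

Definition qle (q r : fracM) : Prop :=
  leM (addM (mulM (qpos q) (qden r)) (mulM (qneg r) (qden q)))
      (addM (mulM (qpos r) (qden q)) (mulM (qneg q) (qden r))).
Definition qlt (q r : fracM) : Prop :=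
  ltM (addM (mulM (qpos q) (qden r)) (mulM (qneg r) (qden q)))
      (addM (mulM (qpos r) (qden q)) (mulM (qneg q) (qden r))).

(* The standard rational (i - j) / (k + 1). *)
Definition qstd (i j k : nat) : fracM :=
  FracM (std M i) (std M j) (@std_neq0 M k).

Definition infinitesimal (q : fracM) : Prop :=
  forall k, qlt (qstd 0 1 k) q /\ qlt q (qstd 1 0 k).

(* For finite q this is the real infinitely close to q; otherwise it is junk. *)
Definition st (R : realType) (q : fracM) : R :=
  sup [set x : R | exists i j k : nat,
    x = ((i%:R - j%:R) / k.+1%:R)%R /\ qle (qstd i j k) q].

End Fractions.

(* A graph on the vertex set {0, ..., k-1}, given by its set of ordered pairs of
   adjacent vertices. *)
Definition is_graph (k : nat) (w : {set 'I_k * 'I_k}) : bool :=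
  [forall x, (x, x) \notin w] &&
  [forall x, forall y, ((x, y) \in w) ==> ((y, x) \in w)].

(* The value at k = 0 is irrelevant: the sequences are indexed by k >= 1. *)
Record wide_seq := WideSeq {
  gset :> forall k, {set {set 'I_k * 'I_k}};
  gset_graph : forall k w, w \in gset k -> is_graph w;
  gset_wide : (fun k => #|gset k|) @ \oo --> \oo }.

Definition graph_code (k : nat) (w : {set 'I_k * 'I_k}) : nat :=
  fset_code [fset x in [seq pair_code e.1 e.2 | e : 'I_k * 'I_k <- enum w]]%fset.
Definition gset_code (G : wide_seq) (k : nat) : nat :=
  fset_code [fset x in [seq graph_code w | w <- enum (G k)]]%fset.

Lemma mem_graph_code k (w : {set 'I_k * 'I_k}) (x y : 'I_k) :
  (pair_code x y \in fset_decode (graph_code w)) = ((x, y) \in w).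
Proof.
rewrite fset_codeK in_fset /=; apply/mapP/idP => [[[x' y']]|xyw]; last first.
  by exists (x, y) => //; rewrite mem_enum.
by rewrite mem_enum => h /pair_code_inj [/val_inj-> /val_inj->].
Qed.

Lemma graph_code_inj k : injective (@graph_code k).
Proof.
move=> w w' h; apply/setP => -[x y].
by rewrite -!mem_graph_code h.
Qed.

Lemma card_gset_code (G : wide_seq) k :
  #|` fset_decode (gset_code G k)|%fset = #|G k|.
Proof.
rewrite fset_codeK card_fseq undup_id ?size_map -?cardE //.
by rewrite map_inj_uniq ?enum_uniq //; exact: graph_code_inj.
Qed.

Section WideLimit.
Variables (M : true_model) (n : M) (nN : nonstandard n) (G : wide_seq).

Definition Gn : M := fun1 (gset_code G) n.

Definition GnT : Type := {w : M | memM w Gn}.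

Lemma nonstandard_ge K : leM (std M K) n.
Proof.
elim: K => [|K IH].
  have := @transfer M 1 (Rel2 (fun x y : nat => x <= y) (Cst 1 0) (X 0)) _
    (tnth [tuple n]).
  by rewrite !satE; apply => v; rewrite !satE.
have := @transfer M 1 (Imp (Rel2 (fun x y : nat => x <= y) (Cst 1 K) (X 0))
   (Or (Eq (X 0) (Cst 1 K))
     (Rel2 (fun x y : nat => x <= y) (Cst 1 K.+1) (X 0)))) _ (tnth [tuple n]).
rewrite !satE => h; case: (h _ IH) => // [v|/nN//].
rewrite !satE leq_eqVlt => /orP[/eqP ->|]; first by left.
by right.
Qed.

Lemma cardGn_neq0 : cardM Gn <> std M 0.
Proof.
have [K _ hK] : \forall k \near \oo, 0 < #|G k|.
  by have /cvgnyPgt /(_ 0) := @gset_wide G.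
have := @transfer M 1 (Imp (Rel2 (fun x y : nat => x <= y) (Cst 1 K) (X 0))
   (Neg (Eq (App1 (fun s : nat => #|` fset_decode s|%fset)
     (App1 (gset_code G) (X 0))) (Cst 1 0)))) _ (tnth [tuple n]).
rewrite !satE; apply; last exact: nonstandard_ge.
move=> v; rewrite !satE => /hK /=; rewrite card_gset_code.
by case: #|_|.
Qed.

Lemma GnT_inj (w w' : GnT) : sval w = sval w' -> w = w'.
Proof.
case: w w' => [x px] [y py] /= e; case: y / e py => py.
by congr exist; exact: Prop_irrelevance.
Qed.

Definition coded (S : set GnT) : Prop :=
  exists a : M, forall x : M, memM x a <-> exists2 w, S w & x = sval w.

Record calA := CalA { aset :> set GnT; asetP : coded aset }.

(* The code is chosen, but by [le_cardM] the cardinality does not depend on it. *)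
Definition acode (A : calA) : M := sval (cid (asetP A)).
Definition acard (A : calA) : M := cardM (acode A).
Definition aratio (A : calA) : fracM M :=
  FracM (acard A) (std M 0) cardGn_neq0.
Definition negligible (A : calA) : Prop := infinitesimal (aratio A).

Lemma calA_eq (A B : calA) : aset A = aset B -> A = B.
Proof.
case: A B => [A pA] [B pB] /= e; case: B / e pB => pB.
by congr CalA; exact: Prop_irrelevance.
Qed.

Lemma coded0 : coded set0.
Proof.
exists (fun2 dif_code Gn Gn) => x; rewrite mem_dif; split=> [[]//|].
by case.
Qed.

Lemma codedC S : coded S -> coded (~` S).
Proof.
move=> [a ha]; exists (fun2 dif_code Gn a) => x; rewrite mem_dif ha.
split=> [[xG nS]|[w nS ->]].
  exists (exist _ x xG) => // Sx; apply: nS; by exists (exist _ x xG).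
split; first exact: (svalP w).
by case=> w' Sw' e; apply: nS; rewrite (_ : w = w') //; exact: GnT_inj.
Qed.

Lemma codedU S S' : coded S -> coded S' -> coded (S `|` S').
Proof.
move=> [a ha] [b hb]; exists (fun2 cup_code a b) => x; rewrite mem_cup ha hb.
split=> [[[w ? ->]|[w ? ->]]|[w [?|?] ->]].
- by exists w => //; left.
- by exists w => //; right.
- by left; exists w.
- by right; exists w.
Qed.

Lemma codedI S S' : coded S -> coded S' -> coded (S `&` S').
Proof.
move=> cS cS'; rewrite -(setCK (S `&` S')) setCI.
by apply: codedC; apply: codedU; apply: codedC.
Qed.

Definition a0 : calA := CalA coded0.
Definition aC (A : calA) : calA := CalA (codedC (asetP A)).
Definition aU (A B : calA) : calA := CalA (codedU (asetP A) (asetP B)).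
Definition aI (A B : calA) : calA := CalA (codedI (asetP A) (asetP B)).
Definition aY (A B : calA) : calA := aU (aI A (aC B)) (aI B (aC A)).

Lemma acard_le (A B : calA) : A `<=` B -> leM (acard A) (acard B).
Proof.
move=> AB; apply: le_cardM => x; rewrite /acode.
case: cid => a /= ->; case: cid => b /= -> [w Aw ->].
by exists w => //; exact: AB.
Qed.

Lemma acard_U (A B : calA) : leM (acard (aU A B)) (addM (acard A) (acard B)).
Proof.
have h1 : leM (acard (aU A B)) (cardM (fun2 cup_code (acode A) (acode B))).
  apply: le_cardM => x; rewrite mem_cup /acode.
  case: cid => c /= ->; case: cid => a /= ->; case: cid => b /= ->.
  by case=> w [?|?] ->; [left|right]; exists w.
have h2 := card_cup (acode A) (acode B).
pose le (x y : nat) := x <= y.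
have := @transfer M 3 (Imp (Rel2 le (X 0) (X 1)) (Imp (Rel2 le (X 1) (X 2))
  (Rel2 le (X 0) (X 2)))) _ (tnth [tuple acard (aU A B);
     cardM (fun2 cup_code (acode A) (acode B)); addM (acard A) (acard B)]).
rewrite !satE; apply=> // v; rewrite !satE /le; exact: leq_trans.
Qed.

Lemma negligibleP A : negligible A <->
  forall k, ltM (mulM (acard A) (std M k.+1)) (cardM Gn).
Proof.
pose lt (x y : nat) := x < y.
split=> h k.
  have [_] := h k.
  have := @transfer M 2 (Imp
    (Rel2 lt (App2 addn (App2 muln (X 0) (Cst 2 k.+1))
                        (App2 muln (Cst 2 0) (X 1)))
             (App2 addn (App2 muln (Cst 2 1) (X 1))
                        (App2 muln (Cst 2 0) (Cst 2 k.+1))))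
    (Rel2 lt (App2 muln (X 0) (Cst 2 k.+1)) (X 1))) _
    (tnth [tuple acard A; cardM Gn]).
  by rewrite !satE; apply=> v; rewrite !satE /lt; lia.
split.
  have := @transfer M 2 (Imp (Neg (Eq (X 1) (Cst 2 0)))
    (Rel2 lt (App2 addn (App2 muln (Cst 2 0) (X 1))
                        (App2 muln (Cst 2 0) (Cst 2 k.+1)))
             (App2 addn (App2 muln (X 0) (Cst 2 k.+1))
                        (App2 muln (Cst 2 1) (X 1))))) _
    (tnth [tuple acard A; cardM Gn]).
  rewrite !satE; apply; last exact: cardGn_neq0.
  by move=> v; rewrite !satE /lt; lia.
have := @transfer M 2 (Imp
    (Rel2 lt (App2 muln (X 0) (Cst 2 k.+1)) (X 1))
    (Rel2 lt (App2 addn (App2 muln (X 0) (Cst 2 k.+1))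
                        (App2 muln (Cst 2 0) (X 1)))
             (App2 addn (App2 muln (Cst 2 1) (X 1))
                        (App2 muln (Cst 2 0) (Cst 2 k.+1))))) _
    (tnth [tuple acard A; cardM Gn]).
rewrite !satE; apply; last exact: h.
by move=> v; rewrite !satE /lt; lia.
Qed.

Lemma negligible_sub (A B : calA) : A `<=` B -> negligible B -> negligible A.
Proof.
move=> /acard_le AB /negligibleP nB; apply/negligibleP => k.
pose lt (x y : nat) := x < y.
pose le (x y : nat) := x <= y.
have := @transfer M 3 (Imp (Rel2 le (X 0) (X 1))
  (Imp (Rel2 lt (App2 muln (X 1) (Cst 3 k.+1)) (X 2))
       (Rel2 lt (App2 muln (X 0) (Cst 3 k.+1)) (X 2)))) _
    (tnth [tuple acard A; acard B; cardM Gn]).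
rewrite !satE; apply; [|exact: AB|exact: nB].
move=> v; rewrite !satE /lt /le => ab; apply: leq_ltn_trans.
by rewrite leq_mul2r ab orbT.
Qed.

Lemma negligibleU (A B : calA) :
  negligible A -> negligible B -> negligible (aU A B).
Proof.
move=> /negligibleP nA /negligibleP nB; apply/negligibleP => k.
have AB := acard_U A B.
pose lt (x y : nat) := x < y.
pose le (x y : nat) := x <= y.
have := @transfer M 4 (Imp (Rel2 le (X 0) (App2 addn (X 1) (X 2)))
  (Imp (Rel2 lt (App2 muln (X 1) (Cst 4 k.*2.+2)) (X 3))
  (Imp (Rel2 lt (App2 muln (X 2) (Cst 4 k.*2.+2)) (X 3))
       (Rel2 lt (App2 muln (X 0) (Cst 4 k.+1)) (X 3))))) _
    (tnth [tuple acard (aU A B); acard A; acard B; cardM Gn]).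
rewrite !satE; apply; [|exact: AB|exact: nA|exact: nB].
move=> v; rewrite !satE /lt /le; set a := v _; set b := v _; set c := v _.
set g := v _ => h hb hc; apply: (@leq_ltn_trans ((b + c) * k.+1)).
  by rewrite leq_mul2r h orbT.
rewrite (_ : k.*2.+2 = k.+1 * 2) in hb hc; last by lia.
rewrite mulnA in hb; rewrite mulnA in hc.
by rewrite mulnDl; lia.
Qed.

Lemma negligible0 : negligible a0.
Proof.
apply/negligibleP => k.
pose lt (x y : nat) := x < y.
pose m (x s : nat) := x \in fset_decode s.
pose cd (s : nat) := #|` fset_decode s|%fset.
pose hd (s : nat) := head 0 (fset_decode s).
have := @transfer M 2 (Imp (Neg (Eq (X 1) (Cst 2 0)))
  (Imp (Neg (Rel2 m (App1 hd (X 0)) (X 0)))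
  (Rel2 lt (App2 muln (App1 cd (X 0)) (Cst 2 k.+1)) (X 1)))) _
    (tnth [tuple acode a0; cardM Gn]).
rewrite !satE; apply; [|exact: cardGn_neq0|].
  move=> v; rewrite !satE /lt /m /cd /hd => /eqP; rewrite -lt0n => v0.
  case: (fset_0Vmem (fset_decode (v (Ordinal (geq_minr 0 1 : minn 0 1 < 2))))).
    by move=> -> _; rewrite cardfs0.
  move=> [x]; set A := fset_decode _ => xA; case.
  have : x \in enum_fset A by [].
  rewrite (_ : (head 0 A \in A) = (head 0 (enum_fset A) \in enum_fset A)) //.
  by case: (enum_fset A) => // y s; rewrite mem_head.
by rewrite /acode; case: cid => a /= h /h [].
Qed.

HB.instance Definition _ := gen_eqMixin calA.
HB.instance Definition _ := gen_choiceMixin calA.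

Definition eqA (A B : calA) : bool := `[< negligible (aY A B) >].

Lemma eqA_refl : reflexive eqA.
Proof.
move=> A; apply/asboolP; apply: negligible_sub negligible0.
by move=> w [[]|[]].
Qed.

Lemma eqA_sym : symmetric eqA.
Proof.
by move=> A B; rewrite /eqA (_ : aY A B = aY B A) //; apply: calA_eq; exact: setUC.
Qed.

Lemma eqA_trans : transitive eqA.
Proof.
move=> B A C /asboolP AB /asboolP BC; apply/asboolP.
apply: negligible_sub (negligibleU AB BC) => w /=.
by case: (pselect (aset B w)); tauto.
Qed.

Canonical eqA_equiv := EquivRel eqA eqA_refl eqA_sym eqA_trans.

Definition calB := {eq_quot eqA}.
HB.instance Definition _ := Choice.on calB.
HB.instance Definition _ := EqQuotient.on calB.

Definition toB (A : calA) : calB := \pi_calB A.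

Lemma toB_eq A B : negligible (aY A B) -> toB A = toB B.
Proof. by move=> h; apply/eqquotP/asboolP. Qed.

Lemma toB_eqP A B : toB A = toB B <-> negligible (aY A B).
Proof. by split=> [/eqquotP/asboolP|/toB_eq]. Qed.

Definition meetB (x y : calB) : calB := toB (aI (repr x) (repr y)).
Definition joinB (x y : calB) : calB := toB (aU (repr x) (repr y)).
Definition complB (x : calB) : calB := toB (aC (repr x)).
Definition botB : calB := toB a0.
Definition topB : calB := toB (aC a0).

Lemma toB_repr (x : calB) : toB (repr x) = x.
Proof. by rewrite /toB reprK. Qed.

Lemma repr_toB A : negligible (aY (repr (toB A)) A).
Proof. by apply/toB_eqP; rewrite toB_repr. Qed.

Lemma meetB_toB A B : meetB (toB A) (toB B) = toB (aI A B).
Proof.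
apply: toB_eq; apply: negligible_sub (negligibleU (repr_toB A) (repr_toB B)).
move=> w /=; case: (pselect (aset A w)); case: (pselect (aset B w));
  case: (pselect (aset (repr (toB A)) w));
  case: (pselect (aset (repr (toB B)) w)); tauto.
Qed.

Lemma joinB_toB A B : joinB (toB A) (toB B) = toB (aU A B).
Proof.
apply: toB_eq; apply: negligible_sub (negligibleU (repr_toB A) (repr_toB B)).
move=> w /=; case: (pselect (aset A w)); case: (pselect (aset B w));
  case: (pselect (aset (repr (toB A)) w));
  case: (pselect (aset (repr (toB B)) w)); tauto.
Qed.

Lemma complB_toB A : complB (toB A) = toB (aC A).
Proof.
apply: toB_eq; apply: negligible_sub (repr_toB A).
by move=> w /=; case: (pselect (aset A w));
  case: (pselect (aset (repr (toB A)) w)); tauto.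
Qed.

Let opE := (meetB_toB, joinB_toB, complB_toB).

Ltac liftB := repeat (let x := fresh in let A := fresh in
  move=> x; rewrite -(toB_repr x); move: (repr x) => A {x});
  rewrite ?opE; congr toB; apply: calA_eq => /=.

Lemma meetBC : commutative meetB. Proof. by liftB; rewrite setIC. Qed.
Lemma joinBC : commutative joinB. Proof. by liftB; rewrite setUC. Qed.
Lemma meetBA : associative meetB. Proof. by liftB; rewrite setIA. Qed.
Lemma joinBA : associative joinB. Proof. by liftB; rewrite setUA. Qed.
Lemma joinBKI y x : meetB x (joinB x y) = x.
Proof. by move: y x; liftB; rewrite setUC setKU. Qed.
Lemma meetBKU y x : joinB x (meetB x y) = x.
Proof. by move: y x; liftB; rewrite setIC setKI. Qed.
Lemma meetBUl : left_distributive meetB joinB.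
Proof. by liftB; rewrite setIUl. Qed.
Lemma meetBxx : idempotent_op meetB. Proof. by liftB; rewrite setIid. Qed.

Fact calB_display : Order.disp_t. Proof. exact: Order.Disp tt tt. Qed.

HB.instance Definition _ :=
  @Order.isMeetJoinDistrLattice.Build calB_display calB
    (fun x y => meetB x y == x) (fun x y => (y != x) && (meetB x y == x))
    meetB joinB (fun _ _ => erefl) (fun _ _ => erefl)
    meetBC joinBC meetBA joinBA joinBKI meetBKU meetBUl meetBxx.

Lemma bot_leB (x : calB) : (botB <= x)%O.
Proof. by apply/eqP; move: x; rewrite /botB; liftB; rewrite set0I. Qed.
Lemma top_geB (x : calB) : (x <= topB)%O.
Proof. by apply/eqP; move: x; rewrite /topB; liftB; rewrite setC0 setIT. Qed.

HB.instance Definition _ := @Order.hasBottom.Build calB_display calB botB bot_leB.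
HB.instance Definition _ := @Order.hasTop.Build calB_display calB topB top_geB.

Lemma joinBxC (x : calB) : (x `|` complB x)%O = \top%O.
Proof.
by move: x; change (forall x, joinB x (complB x) = topB); rewrite /topB;
  liftB; rewrite setUv setC0.
Qed.
Lemma meetBxC (x : calB) : (x `&` complB x)%O = \bot%O.
Proof.
by move: x; change (forall x, meetB x (complB x) = botB); rewrite /botB;
  liftB; rewrite setICr.
Qed.

HB.instance Definition _ :=
  @Order.TBDistrLattice_hasComplement.Build calB_display calB
    complB joinBxC meetBxC.

Lemma toB_le A B : (toB A <= toB B)%O <-> negligible (aI A (aC B)).
Proof.
transitivity (meetB (toB A) (toB B) = toB A); first by split=> /eqP.
rewrite opE toB_eqP; split; apply: negligible_sub => w /=; last tauto.
by case: (pselect (aset A w)); case: (pselect (aset B w)); tauto.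
Qed.

Definition mu (R : realType) (b : calB) : R := st R (aratio (repr b)).

Lemma st_le (R : realType) (A B : calA) : negligible (aY A B) ->
  (st R (aratio A) <= st R (aratio B))%R.
Proof.
move=> /negligibleP nY.
have hBG : leM (acard B) (cardM Gn).
  apply: le_cardM => x; rewrite /acode; case: cid => b /= -> [w _ ->].
  exact: (svalP w).
have hAB : leM (acard A) (addM (acard B) (acard (aY A B))).
  have h1 : leM (acard A) (acard (aU B (aY A B))).
    by apply: acard_le => w /=; case: (pselect (aset B w)); tauto.
  have h2 := acard_U B (aY A B).
  pose le (x y : nat) := x <= y.
  have := @transfer M 3 (Imp (Rel2 le (X 0) (X 1)) (Imp (Rel2 le (X 1) (X 2))
    (Rel2 le (X 0) (X 2)))) _ (tnth [tuple acard A;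
     acard (aU B (aY A B)); addM (acard B) (acard (aY A B))]).
  by rewrite !satE; apply=> // v; rewrite !satE /le; exact: leq_trans.
pose le (x y : nat) := x <= y.
pose lt (x y : nat) := x < y.
(* low i j k a g : (i - j) / (k + 1) <= a / g *)
pose low l (i j k : nat) (a g : term l) := Rel2 le
  (App2 addn (App2 muln (Cst l i) g) (App2 muln (Cst l 0) (Cst l k.+1)))
  (App2 addn (App2 muln a (Cst l k.+1)) (App2 muln (Cst l j) g)).
have ub i j k : qle (qstd M i j k) (aratio B) -> i <= k.+1 + j.
  move=> h; rewrite leqNgt; apply/negP => hi.
  have := @transfer M 2 (Imp (low 2 i j k (X 0) (X 1))
    (Imp (Rel2 le (X 0) (X 1)) (Eq (X 1) (Cst 2 0)))) _
    (tnth [tuple acard B; cardM Gn]).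
  rewrite /low !satE => H; apply: cardGn_neq0; apply: H; [|exact: h|exact: hBG].
  move=> v; rewrite !satE /le; set g := v _; set b := v _ => h1 h2.
  apply/eqP; rewrite -leqn0 leqNgt; apply/negP => g0.
  have h3 : b * k.+1 <= g * k.+1 by rewrite leq_mul2r h2 orbT.
  have h4 : (k.+1 + j).+1 * g <= i * g by rewrite leq_mul2r hi orbT.
  by move: h1 h3 h4; rewrite !mulSn !mulnS mulnDl; lia.
have bdB : has_ubound [set x : R | exists i j k : nat,
    x = ((i%:R - j%:R) / k.+1%:R)%R /\ qle (qstd M i j k) (aratio B)].
  exists 1%R => _ [i [j [k [-> /ub h]]]].
  rewrite ler_pdivrMr ?ltr0n // mul1r lerBlDr -natrD ler_nat.
  exact: h.
apply: ge_sup.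
  exists 0%R; exists 0, 0, 0; split; first by rewrite subrr mul0r.
  have := @transfer M 2 (low 2 0 0 0 (X 0) (X 1)) _
    (tnth [tuple acard A; cardM Gn]).
  by rewrite /low !satE; apply=> v; rewrite !satE /le; lia.
move=> _ [i [j [k [-> h]]]].
apply/ler_addgt0Pr => e e0.
have [m me] : exists m : nat, (m.+1%:R^-1 < e :> R)%R.
  exists (Num.truncn e^-1); rewrite invf_plt ?posrE ?ltr0n //.
  exact: truncnS_gt.
apply: (@le_trans _ _ (st R (aratio B) + m.+1%:R^-1)%R); last first.
  by rewrite lerD2l ltW.
rewrite -lerBlDr; apply: ub_le_sup => //.
exists (i * m.+1), (j * m.+1 + k.+1), (k.+1 * m.+1).-1; split.
  rewrite prednK ?muln_gt0 // natrD !natrM opprD addrA -mulrBl.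
  by field; rewrite !nat1r !pnatr_eq0.
have := @transfer M 4 (Imp (low 4 i j k (X 0) (X 3))
  (Imp (Rel2 le (X 0) (App2 addn (X 1) (X 2)))
  (Imp (Rel2 lt (App2 muln (X 2) (Cst 4 m.+1)) (X 3))
    (low 4 (i * m.+1) (j * m.+1 + k.+1) (k.+1 * m.+1).-1 (X 1) (X 3))))) _
  (tnth [tuple acard A; acard B; acard (aY A B); cardM Gn]).
rewrite /low !satE; apply; [|exact: h|exact: hAB|exact: nY].
move=> v; rewrite !satE /le /lt prednK ?muln_gt0 //.
set g := v _; set a := v _; set b := v _; set y := v _.
rewrite !mul0n !addn0 => h1 h2 h3.
have h4 : a * k.+1 * m.+1 <= (b + y) * k.+1 * m.+1.
  by rewrite !leq_mul2r h2 !orbT.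
have h5 : i * g * m.+1 <= (a * k.+1 + j * g) * m.+1.
  by rewrite leq_mul2r h1 orbT.
have h6 : y * m.+1 * k.+1 <= g * k.+1 by rewrite leq_mul2r (ltnW h3) orbT.
by move: h4 h5 h6; set m' := m.+1; set k' := k.+1; nia.
Qed.

Lemma mu_toB (R : realType) (A : calA) : mu R (toB A) = st R (aratio A).
Proof.
have h := repr_toB A; apply/eqP; rewrite eq_le !st_le //.
by rewrite (_ : aY _ _ = aY (repr (toB A)) A) //; apply: calA_eq; exact: setUC.
Qed.

(* alpha is coded through its graph. *)
Definition coded_fun (alpha : GnT -> M) : Prop :=
  exists a : M, forall x : M,
    memM x a <-> exists w, x = pairM (sval w) (alpha w).

Record rv_family := RVFamily {
  rv :> set (GnT -> M);
  rv_coded : forall alpha, rv alpha -> coded_fun alpha }.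

Definition Edge (w : GnT) (x y : M) : Prop := memM (pairM x y) (sval w).

Section Comprehension.

Definition unpair_code (e : nat) : nat * nat :=
  odflt (0, 0) (choice.unpickle e).
Lemma pair_codeK x y : unpair_code (pair_code x y) = (x, y).
Proof. by rewrite /unpair_code /pair_code choice.pickleK. Qed.

Definition app_code (c w : nat) : nat :=
  xget 0 [set y | pair_code w y \in fset_decode c].

Definition compr_code (r : nat -> nat -> bool) (g e : nat) : nat :=
  fset_code [fset w in fset_decode g | r w e]%fset.

Lemma pairM_inj (x y x' y' : M) :
  pairM x y = pairM x' y' -> x = x' /\ y = y'.
Proof.
have := @transfer M 4 (Imp
  (Eq (App2 pair_code (X 0) (X 1)) (App2 pair_code (X 2) (X 3)))
  (And (Eq (X 0) (X 2)) (Eq (X 1) (X 3)))) _ (tnth [tuple x; y; x'; y']).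
by rewrite !satE; apply => v; rewrite !satE; exact: pair_code_inj.
Qed.

Lemma app_codeE (alpha : GnT -> M) (c : M) :
  (forall x : M, memM x c <-> exists w, x = pairM (sval w) (alpha w)) ->
  forall w, fun2 app_code c (sval w) = alpha w.
Proof.
move=> hc w; pose m (x s : nat) := x \in fset_decode s.
have := @transfer M 3 (Imp (Rel2 m (App2 pair_code (X 0) (X 1)) (X 2))
  (Rel2 m (App2 pair_code (X 0) (App2 app_code (X 2) (X 0))) (X 2))) _
  (tnth [tuple sval w; alpha w; c]).
rewrite !satE => H.
have /hc[w' /pairM_inj[/GnT_inj <- //]] :
    memM (pairM (sval w) (fun2 app_code c (sval w))) c.
  apply: H; last by apply/hc; exists w.
  move=> v; rewrite !satE /m /app_code => h.
  by case: xgetP => [y _ //|/(_ _ h)].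
Qed.

Lemma coded_compr (P : GnT -> Prop) (r : nat -> nat -> bool) (e : M) :
  (forall w, P w <-> rel2 r (sval w) e) -> coded P.
Proof.
move=> hP; exists (fun2 (compr_code r) Gn e) => x.
pose m (x s : nat) := x \in fset_decode s.
have := @transfer M 3 (And
  (Imp (Rel2 m (X 0) (App2 (compr_code r) (X 1) (X 2)))
    (And (Rel2 m (X 0) (X 1)) (Rel2 r (X 0) (X 2))))
  (Imp (And (Rel2 m (X 0) (X 1)) (Rel2 r (X 0) (X 2)))
    (Rel2 m (X 0) (App2 (compr_code r) (X 1) (X 2))))) _ (tnth [tuple x; Gn; e]).
rewrite !satE => H; case: H => [v|h1 h2].
  by rewrite !satE /m /compr_code fset_codeK !inE; split=> /andP.
split=> [/h1[xG rx]|[w /hP rw xw]]; last first.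
  by apply: h2; split; rewrite xw; [exact: (svalP w)|exact: rw].
by exists (exist _ x xG) => //; apply/hP.
Qed.

End Comprehension.

Lemma coded_eq alpha beta : coded_fun alpha -> coded_fun beta ->
  coded [set w | alpha w = beta w].
Proof.
move=> [c hc] [d hd].
pose r (w e : nat) := app_code (unpair_code e).1 w == app_code (unpair_code e).2 w.
apply: (@coded_compr _ r (pairM c d)) => w /=.
rewrite -(app_codeE hc) -(app_codeE hd).
have := @transfer M 3 (And
  (Imp (Eq (App2 app_code (X 1) (X 0)) (App2 app_code (X 2) (X 0)))
    (Rel2 r (X 0) (App2 pair_code (X 1) (X 2))))
  (Imp (Rel2 r (X 0) (App2 pair_code (X 1) (X 2)))
   (Eq (App2 app_code (X 1) (X 0)) (App2 app_code (X 2) (X 0))))) _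
  (tnth [tuple sval w; c; d]).
by rewrite !satE; apply => v; rewrite !satE /r pair_codeK /=; split=> [->|/eqP].
Qed.

Lemma coded_Edge alpha beta : coded_fun alpha -> coded_fun beta ->
  coded [set w | Edge w (alpha w) (beta w)].
Proof.
move=> [c hc] [d hd].
pose r (w e : nat) := pair_code (app_code (unpair_code e).1 w)
  (app_code (unpair_code e).2 w) \in fset_decode w.
apply: (@coded_compr _ r (pairM c d)) => w /=.
rewrite -(app_codeE hc) -(app_codeE hd).
pose m (x s : nat) := x \in fset_decode s.
pose ed := Rel2 m (App2 pair_code (App2 app_code (X 1) (X 0))
  (App2 app_code (X 2) (X 0))) (@X 2 0).
have := @transfer M 3 (And
  (Imp ed (Rel2 r (X 0) (App2 pair_code (X 1) (X 2))))
  (Imp (Rel2 r (X 0) (App2 pair_code (X 1) (X 2))) ed)) _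
  (tnth [tuple sval w; c; d]).
by rewrite /ed !satE; apply => v; rewrite !satE /r pair_codeK.
Qed.

Definition U (F : rv_family) : Type :=
  {alpha : GnT -> M | rv F alpha /\ forall w, ltM (alpha w) n}.

Lemma U_coded (F : rv_family) (alpha : U F) : coded_fun (sval alpha).
Proof. exact: rv_coded (svalP alpha).1. Qed.

Definition eqU (F : rv_family) (alpha beta : U F) : calA :=
  CalA (coded_eq (U_coded alpha) (U_coded beta)).
Definition EdgeU (F : rv_family) (alpha beta : U F) : calA :=
  CalA (coded_Edge (U_coded alpha) (U_coded beta)).

End WideLimit.

(* {E}-formulas with free variables among x_0, ..., x_(l-1); [GEx] and [GAll]
   bind the last variable x_l of their argument. *)
Inductive gform (l : nat) : Type :=
| GEq of 'I_l & 'I_l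
| GE of 'I_l & 'I_l
| GNeg of gform l
| GAnd of gform l & gform l
| GOr of gform l & gform l
| GEx of gform l.+1
| GAll of gform l.+1.

Fixpoint gopen l (phi : gform l) : bool :=
  match phi with
  | GEq _ _ | GE _ _ => true
  | GNeg a => gopen a
  | GAnd a b | GOr a b => gopen a && gopen b
  | GEx _ | GAll _ => false
  end.

(* (exists x_0) ... (exists x_(l-1)) phi *)
Fixpoint gexs l : gform l -> gform 0 :=
  if l is l'.+1 then fun phi => gexs (GEx phi) else fun phi => phi.

Fixpoint gsat k (w : {set 'I_k * 'I_k}) l (phi : gform l) :
    ('I_l -> 'I_k) -> bool :=
  match phi with
  | GEq i j => fun v => v i == v j
  | GE i j => fun v => (v i, v j) \in w
  | GNeg a => fun v => ~~ gsat w a v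
  | GAnd a b => fun v => gsat w a v && gsat w b v
  | GOr a b => fun v => gsat w a v || gsat w b v
  | GEx a => fun v => [exists x, gsat w a (vext v x)]
  | GAll a => fun v => [forall x, gsat w a (vext v x)]
  end.

Definition unif_prob (R : realType) (T : finType) (D P : pred T) : R :=
  (#|[pred x in D | P x]|%:R / #|D|%:R)%R.

(* omega uniform in G_k, (a_0, ..., a_(l-1)) uniform in {0, ..., k-1}^l *)
Definition prob_sat (R : realType) (G : wide_seq) l (phi : gform l) (k : nat) : R :=
  unif_prob R
    [pred wa : {set 'I_k * 'I_k} * {ffun 'I_l -> 'I_k} | wa.1 \in G k]
    (fun wa => gsat wa.1 phi wa.2).

Section WideLimitTruth.
Variables (M : true_model) (n : M) (nN : nonstandard n) (G : wide_seq).
Variable F : rv_family n G.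

(* Pitfall: [supremum] and [infimum] return junk when no bound exists; they are
   the joins and meets below because [calB] is complete when M is
   [aleph1_saturated]. *)
Fixpoint wtruth l (phi : gform l) : ('I_l -> U F) -> calB nN G :=
  match phi with
  | GEq i j => fun v => toB nN (eqU (v i) (v j))
  | GE i j => fun v => toB nN (EdgeU (v i) (v j))
  | GNeg a => fun v => (~` wtruth a v)%O
  | GAnd a b => fun v => (wtruth a v `&` wtruth b v)%O
  | GOr a b => fun v => (wtruth a v `|` wtruth b v)%O
  | GEx a => fun v =>
      supremum \bot%O (range (fun alpha => wtruth a (vext v alpha)))
  | GAll a => fun v =>
      infimum \top%O (range (fun alpha => wtruth a (vext v alpha)))
  end.

Definition wide_limit (sigma : gform 0) : calB nN G :=
  wtruth sigma (@vnil (U F)).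

End WideLimitTruth.

(* Main.v *)
Require Import Defs.
From mathcomp Require Import all_boot all_order all_algebra finmap.
From mathcomp Require Import all_classical reals topology normedtype sequences.
From mathcomp Require Import zify lra.
Set Implicit Arguments.
Unset Strict Implicit.
Unset Printing Implicit Defensive.
Import Order.TTheory GRing.Theory Num.Theory numFieldNormedType.Exports Order.CTheory.
Local Open Scope classical_set_scope.
Local Open Scope ring_scope.

(** Averaging over the tuples of vertices, some tuple a has at least the average
    number of graphs satisfying phi(a).  So, for every rational q < p, all large
    standard k have vertices a_0, ..., a_(l-1) of {0, ..., k-1} such that at least
    a fraction q of the graphs of G_k satisfy phi at them.  Choosing such vertices
    for each k gives l functions on the natural numbers, hence function symbols
    of the language; their values at n are l nonstandard vertices, and by
    transfer at least a fraction q of the graphs of G_n satisfy phi at them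
    ([ratio_le_mu_gexs]).  Constant functions belong to F, so these values are
    F-vertices.  As phi is open, its truth value at them is the class of the set
    of graphs that satisfy it ([wtruth_const]), which has measure at least q, and
    it lies below the truth value of the existential closure of phi
    ([le_wtruth_gexs]).  Letting q tend to p gives the bound.

    The last comparison needs the joins that interpret the existential
    quantifiers to exist, for arbitrary F: this is the completeness of the
    Boolean algebra ([calB_complete]), and it is here that saturation enters.
    The measure is additive ([mu_split]) and strictly positive ([mu_pos]), and
    saturation bounds an increasing sequence of elements of measure at most s by
    an element of measure at most s ([mu_chain]): the sets in question contain
    given representatives and satisfy countably many bounds on their size, and
    any finitely many of these requirements are met by one representative.  These
    properties force every set S of elements to have a join
    ([complete_of_measure]): approximate the supremum s of the measures of the
    elements lying below all upper bounds of S by an increasing sequence of such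
    elements; a bound of measure at most s of that sequence is the join.

    Real-valued statements about the standard part reduce to comparing a ratio
    |A| / |G_n| with standard rationals i / (k + 1), which is first order and so
    can be transferred. *)

(** * Standard parts of cardinality ratios *)

Lemma exists_ratio_between (R : realType) (x y : R) : 0 <= x -> x < y ->
  exists i k : nat, x < i%:R / k.+1%:R < y.
Proof.
move=> x0 xy.
have yx : 0 < y - x by rewrite subr_gt0.
pose k := Num.truncn (y - x)^-1.
have hk : (y - x)^-1 < k.+1%:R := truncnS_gt _.
have xk0 : 0 <= x * k.+1%:R by rewrite mulr_ge0.
exists (Num.truncn (x * k.+1%:R)).+1, k.
rewrite ltr_pdivlMr ?ltr0n // ltr_pdivrMr ?ltr0n // truncnS_gt /=.
have : (Num.truncn (x * k.+1%:R))%:R <= x * k.+1%:R by rewrite truncn_le.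
move: hk; rewrite -(ltr_pM2l yx) mulfV ?gt_eqF // -natr1; lra.
Qed.

Section Ratio.
Variables (M : true_model) (n : M) (nN : nonstandard n) (G : wide_seq).
Implicit Types (A B : calA n G) (i j k : nat).

Let le (x y : nat) := (x <= y)%N.
Let lt (x y : nat) := (x < y)%N.
Let cd (s : nat) := #|` fset_decode s|%fset.

Lemma mem_acode A z : memM z (acode A) <-> exists2 w, aset A w & z = sval w.
Proof. by rewrite /acode; case: cid. Qed.

(** i / (k + 1) <= |A| / |G_n|, cleared of denominators. *)
Definition ratio_ge A i k : Prop :=
  leM (mulM (std M i) (cardM (Gn n G))) (mulM (acard A) (std M k.+1)).

Definition ratio_le A i k : Prop :=
  leM (mulM (acard A) (std M k.+1)) (mulM (std M i) (cardM (Gn n G))).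

(** [acode] is chosen arbitrarily; this computes the cardinality from any code. *)
Lemma acardE A (a : M) :
  (forall x, memM x a <-> exists2 w, aset A w & x = sval w) ->
  acard A = cardM a.
Proof.
move=> ha.
have h1 : leM (acard A) (cardM a).
  by apply: le_cardM => x /mem_acode/ha.
have h2 : leM (cardM a) (acard A).
  by apply: le_cardM => x /ha/mem_acode.
have := @transfer M 2 (Imp (Rel2 le (X 0) (X 1)) (Imp (Rel2 le (X 1) (X 0))
  (Eq (X 0) (X 1)))) _ (tnth [tuple acard A; cardM a]).
rewrite !satE; apply=> // v; rewrite !satE /le => ? ?.
by apply/eqP; rewrite eqn_leq; apply/andP.
Qed.

Lemma acard_le_Gn A : leM (acard A) (cardM (Gn n G)).
Proof.
by apply: le_cardM => x /mem_acode[w _ ->]; exact: (svalP w).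
Qed.

Lemma ratio_total A i k : ratio_ge A i k \/ ratio_le A i k.
Proof.
have := @transfer M 2 (Or
  (Rel2 le (App2 muln (Cst 2 i) (X 1)) (App2 muln (X 0) (Cst 2 k.+1)))
  (Rel2 le (App2 muln (X 0) (Cst 2 k.+1)) (App2 muln (Cst 2 i) (X 1)))) _
  (tnth [tuple acard A; cardM (Gn n G)]).
by rewrite !satE; apply=> v; rewrite !satE /le; lia.
Qed.

Lemma ratio_ge0 A k : ratio_ge A 0 k.
Proof.
have := @transfer M 2
  (Rel2 le (App2 muln (Cst 2 0) (X 1)) (App2 muln (X 0) (Cst 2 k.+1))) _
  (tnth [tuple acard A; cardM (Gn n G)]).
by rewrite !satE; apply=> v; rewrite !satE /le; lia.
Qed.

Lemma ratio_le1 A k : ratio_le A k.+1 k.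
Proof.
have := @transfer M 2 (Imp (Rel2 le (X 0) (X 1))
  (Rel2 le (App2 muln (X 0) (Cst 2 k.+1)) (App2 muln (Cst 2 k.+1) (X 1)))) _
  (tnth [tuple acard A; cardM (Gn n G)]).
rewrite !satE; apply; last exact: acard_le_Gn.
by move=> v; rewrite !satE /le mulnC leq_mul2l => ->; rewrite orbT.
Qed.

(** The integer part of (k + 1) |A| / |G_n| is standard because the ratio is at
    most 1; it is found as a least number among standard ones. *)
Lemma ratio_bracket A k : exists i, ratio_ge A i k /\ ratio_le A i.+1 k.
Proof.
have ex : exists i, `[< ratio_le A i.+1 k >].
  by exists k; apply/asboolP/ratio_le1.
case: (ex_minnP ex) => -[|i] /asboolP hi imin.
  by exists 0%N; split=> //; exact: ratio_ge0.
exists i.+1; split=> //; case: (ratio_total A i.+1 k) => // /asboolP /imin.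
by rewrite ltnn.
Qed.

(** The upper bound |A| / |G_n| <= i / (k + 1) bounds every standard rational
    (i' - j') / (k' + 1) in the cut that defines the standard part. *)
Lemma ratio_le_qle A i k i' j' k' : ratio_le A i k ->
  qle (qstd M i' j' k') (aratio nN A) ->
  (i' * k.+1 <= i * k'.+1 + j' * k.+1)%N.
Proof.
move=> hA hq; rewrite leqNgt; apply/negP => hlt.
have := @transfer M 2 (Imp
  (Rel2 le (App2 muln (X 0) (Cst 2 k.+1)) (App2 muln (Cst 2 i) (X 1)))
  (Imp (Rel2 le
    (App2 addn (App2 muln (Cst 2 i') (X 1)) (App2 muln (Cst 2 0) (Cst 2 k'.+1)))
    (App2 addn (App2 muln (X 0) (Cst 2 k'.+1)) (App2 muln (Cst 2 j') (X 1))))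
    (Eq (X 1) (Cst 2 0)))) _ (tnth [tuple acard A; cardM (Gn n G)]).
rewrite !satE => H; apply: (cardGn_neq0 nN (G := G)).
apply: H; [|exact: hA|exact: hq].
move=> v; rewrite !satE /le; set a := v _; set g := v _ => h1 h2.
have h3 : (i' * g * k.+1 <= (a * k'.+1 + j' * g) * k.+1)%N.
  by rewrite leq_mul2r; apply/orP; right; lia.
have h4 : (a * k.+1 * k'.+1 <= i * g * k'.+1)%N by rewrite leq_mul2r h1 orbT.
have h5 : ((i * k'.+1 + j' * k.+1).+1 * g <= i' * k.+1 * g)%N.
  by rewrite leq_mul2r hlt orbT.
move: h3 h4 h5; set K := k.+1; set K' := k'.+1; nia.
Qed.

Variable R : realType.

Lemma st_le_ratio A i k : ratio_le A i k ->
  st R (aratio nN A) <= i%:R / k.+1%:R.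
Proof.
move=> hA; apply: ge_sup.
  exists 0, 0%N, 0%N, 0%N; split; first by rewrite subrr mul0r.
  have := @transfer M 2 (Rel2 le
    (App2 addn (App2 muln (Cst 2 0) (X 1)) (App2 muln (Cst 2 0) (Cst 2 1)))
    (App2 addn (App2 muln (X 0) (Cst 2 1)) (App2 muln (Cst 2 0) (X 1)))) _
    (tnth [tuple acard A; cardM (Gn n G)]).
  by rewrite !satE; apply=> v; rewrite !satE /le; lia.
move=> _ [i' [j' [k' [-> /(ratio_le_qle hA) h]]]].
rewrite ler_pdivrMr ?ltr0n // mulrAC ler_pdivlMr ?ltr0n // mulrBl lerBlDr.
by rewrite -!natrM -natrD ler_nat.
Qed.

Lemma st_ge_ratio A i k : ratio_ge A i k ->
  i%:R / k.+1%:R <= st R (aratio nN A).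
Proof.
move=> hA; apply: ub_le_sup.
  exists 1 => _ [i' [j' [k' [-> /(ratio_le_qle (ratio_le1 A 0)) h]]]].
  rewrite ler_pdivrMr ?ltr0n // mul1r lerBlDr -natrD ler_nat.
  by move: h; rewrite !muln1 mul1n.
exists i, 0%N, k; split; first by rewrite subr0.
have := @transfer M 2 (Imp
  (Rel2 le (App2 muln (Cst 2 i) (X 1)) (App2 muln (X 0) (Cst 2 k.+1)))
  (Rel2 le
    (App2 addn (App2 muln (Cst 2 i) (X 1)) (App2 muln (Cst 2 0) (Cst 2 k.+1)))
    (App2 addn (App2 muln (X 0) (Cst 2 k.+1)) (App2 muln (Cst 2 0) (X 1))))) _
  (tnth [tuple acard A; cardM (Gn n G)]).
by rewrite !satE; apply=> // v; rewrite !satE /le; lia.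
Qed.

Lemma ratio_le_of_st_lt A i k : st R (aratio nN A) < i%:R / k.+1%:R ->
  ratio_le A i k.
Proof. by case: (ratio_total A i k) => // /st_ge_ratio; rewrite leNgt => /negP. Qed.

(** Additivity.  The internal cardinalities add up exactly; the standard parts
    then agree up to 2 / (k + 1) for each k, since bracketing both summands
    between consecutive multiples of 1 / (k + 1) brackets the sum. *)
Lemma st_split A B : st R (aratio nN A) =
  st R (aratio nN (aI A B)) + st R (aratio nN (aI A (aC B))).
Proof.
pose a := acode A; pose b := acode B.
have hD : acard (aI A (aC B)) = cardM (fun2 dif_code a b).
  apply: acardE => x; rewrite mem_dif !mem_acode; split.
    by case=> -[w Aw ->] nB; exists w => //; split=> // Bw; apply: nB; exists w.
  case=> w [Aw nBw] ->; split; first by exists w.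
  by case=> w' Bw' /GnT_inj e; apply: nBw; rewrite e.
have hI : acard (aI A B) = cardM (fun2 dif_code a (fun2 dif_code a b)).
  apply: acardE => x; rewrite !mem_dif !mem_acode; split.
    case=> -[w Aw ->] nn; exists w => //; split=> //.
    apply: contrapT => nB; apply: nn; split; first by exists w.
    by case=> w' Bw' /GnT_inj e; apply: nB; rewrite e.
  case=> w [Aw Bw] ->; split; first by exists w.
  by case=> _; apply; exists w.
have cardE : acard A = addM (acard (aI A B)) (acard (aI A (aC B))).
  rewrite hI hD.
  have := @transfer M 2 (Eq (App1 cd (X 0))
    (App2 addn (App1 cd (App2 dif_code (X 0) (App2 dif_code (X 0) (X 1))))
      (App1 cd (App2 dif_code (X 0) (X 1))))) _ (tnth [tuple a; b]).
  rewrite !satE; apply=> v; rewrite !satE /cd !fset_codeK.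
  by rewrite fsetDDr fsetDv fset0U cardfsID.
apply/eqP; rewrite -subr_eq0 -normr_le0; apply/ler_addgt0Pr => e e0.
pose k' := Num.truncn (2 / e).
have hk' : 2 / k'.+1%:R < e.
  by rewrite ltr_pdivrMr ?ltr0n // mulrC -ltr_pdivrMr // truncnS_gt.
have [i [gi li]] := ratio_bracket (aI A B) k'.
have [j [gj lj]] := ratio_bracket (aI A (aC B)) k'.
have gA : ratio_ge A (i + j) k'.
  have := @transfer M 3 (Imp
    (Rel2 le (App2 muln (Cst 3 i) (X 2)) (App2 muln (X 0) (Cst 3 k'.+1))) (Imp
    (Rel2 le (App2 muln (Cst 3 j) (X 2)) (App2 muln (X 1) (Cst 3 k'.+1)))
    (Rel2 le (App2 muln (Cst 3 (i + j)) (X 2))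
      (App2 muln (App2 addn (X 0) (X 1)) (Cst 3 k'.+1))))) _
    (tnth [tuple acard (aI A B); acard (aI A (aC B)); cardM (Gn n G)]).
  rewrite /ratio_ge cardE !satE; apply; [|exact: gi|exact: gj].
  by move=> v; rewrite !satE /le !mulnDl; exact: leq_add.
have lA : ratio_le A (i.+1 + j.+1) k'.
  have := @transfer M 3 (Imp
    (Rel2 le (App2 muln (X 0) (Cst 3 k'.+1)) (App2 muln (Cst 3 i.+1) (X 2))) (Imp
    (Rel2 le (App2 muln (X 1) (Cst 3 k'.+1)) (App2 muln (Cst 3 j.+1) (X 2)))
    (Rel2 le (App2 muln (App2 addn (X 0) (X 1)) (Cst 3 k'.+1))
      (App2 muln (Cst 3 (i.+1 + j.+1)) (X 2))))) _
    (tnth [tuple acard (aI A B); acard (aI A (aC B)); cardM (Gn n G)]).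
  rewrite /ratio_le cardE !satE; apply; [|exact: li|exact: lj].
  by move=> v; rewrite !satE /le !mulnDl; exact: leq_add.
move: (st_ge_ratio gi) (st_ge_ratio gj) (st_ge_ratio gA).
move: (st_le_ratio li) (st_le_ratio lj) (st_le_ratio lA) hk'.
rewrite !natrD -!natr1 !mulrDl !mul1r.
set u := (_ + 1)^-1 => *; rewrite add0r ler_norml; apply/andP; lra.
Qed.

Lemma st_eq0_negligible A : st R (aratio nN A) <= 0 -> negligible nN A.
Proof.
move=> hA; apply/negligibleP => k.
have := @transfer M 2 (Or
  (Rel2 le (App2 muln (Cst 2 1) (X 1)) (App2 muln (X 0) (Cst 2 k.+1)))
  (Rel2 lt (App2 muln (X 0) (Cst 2 k.+1)) (X 1))) _
  (tnth [tuple acard A; cardM (Gn n G)]).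
rewrite !satE => H; case: H => // [v|h].
  by rewrite !satE /le /lt; lia.
have /st_ge_ratio : ratio_ge A 1 k by [].
by move=> /le_trans /(_ hA); rewrite mul1r invr_le0 lern0.
Qed.

End Ratio.

(** * Completeness from a strictly positive measure *)

Section Completeness.
Variables (d : Order.disp_t) (L : ctbDistrLatticeType d) (R : realType).
Variable mu : L -> R.
Hypothesis mu_ge0 : forall x, 0 <= mu x.
Hypothesis mu_split : forall x y : L,
  mu x = mu (x `&` y)%O + mu (x `&` ~` y)%O.
Hypothesis mu_pos : forall x, mu x = 0 -> x = \bot%O.
Hypothesis mu_chain : forall (x : nat -> L) (s : R),
  (forall i, x i <= x i.+1)%O -> (forall i, mu (x i) <= s) ->
  exists z, (forall i, x i <= z)%O /\ mu z <= s.

Lemma measure_le x y : (x <= y)%O -> mu x <= mu y.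
Proof.
move=> /meet_idPr xy; rewrite (mu_split y x) xy lerDl; exact: mu_ge0.
Qed.

(** The lower bounds T of the upper bounds of S contain S and are closed under
    binary joins, so T can replace the finite joins of elements of S: an
    increasing sequence in T whose measures tend to their supremum s over T
    exhausts S up to measure 0.  Any bound z of the sequence with measure at most
    s is then the join, because y - z for y in S, and z - b for an upper bound b
    of S, both have measure 0. *)
Lemma complete_of_measure (S : set L) : supremums S !=set0.
Proof.
pose T := lbound (ubound S).
have ST y : S y -> T y by move=> Sy b; apply.
have TU x y : T x -> T y -> T (x `|` y)%O.
  by move=> Tx Ty b ub; rewrite leUx (Tx _ ub) (Ty _ ub).
have hsT : has_sup (mu @` T).
  split; first by exists (mu \bot%O), \bot%O => // b _; exact: le0x.
  by exists (mu \top%O) => _ [x _ <-]; apply: measure_le; exact: lex1.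
pose s := sup (mu @` T).
have Ts x : T x -> mu x <= s by move=> Tx; apply: sup_upper_bound => //; exists x.
have /choice[t ht] : forall i : nat, exists x, T x /\ s - i.+1%:R^-1 < mu x.
  move=> i; have e0 : 0 < i.+1%:R^-1 :> R by rewrite invr_gt0 ltr0n.
  by have [_ [x Tx <-] h] := sup_adherent e0 hsT; exists x.
pose x i := (\join_(j < i.+1) t j)%O.
have xS i : x i.+1 = (x i `|` t i.+1)%O by rewrite /x big_ord_recr.
have Tx i : T (x i).
  elim: i => [|i IH]; first by rewrite /x big_ord1; case: (ht 0%N).
  by rewrite xS; apply: TU => //; case: (ht i.+1).
have tx i : (t i <= x i)%O.
  by case: i => [|i]; [rewrite /x big_ord1|rewrite xS leUr].
have mux i : s - i.+1%:R^-1 < mu (x i).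
  by case: (ht i) => _ /lt_le_trans; apply; exact: measure_le.
have [|i|z [xz zs]] := @mu_chain x s; first by move=> i; rewrite xS leUl.
  exact: Ts.
have small y : (forall i, mu y <= s - mu (x i)) -> y = \bot%O.
  move=> hy; apply/mu_pos/eqP; rewrite eq_le mu_ge0 andbT.
  apply/ler_addgt0Pr => e e0; rewrite add0r.
  pose k := Num.truncn e^-1.
  have hk : k.+1%:R^-1 < e by rewrite invf_plt ?posrE ?ltr0n // truncnS_gt.
  have := hy k; have := mux k; move: hk; set u := _^-1 => *; lra.
have le_of_diff (a b : L) : (a `&` ~` b)%O = \bot%O -> (a <= b)%O.
  by rewrite -diffE => h; rewrite -diff_eq0 h.
exists z; split.
  (* Adding y to x i stays in T, so y adds at most s - mu (x i). *)
  move=> y Sy; apply/le_of_diff/small => i.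
  have := Ts _ (TU _ _ (Tx i) (ST _ Sy)).
  rewrite (mu_split (x i `|` y)%O (x i)) meetC joinKI.
  suff : mu (y `&` ~` z)%O <= mu ((x i `|` y) `&` ~` x i)%O by lra.
  by apply/measure_le/leI2; [exact: leUr|rewrite leC].
(* b is above x i, which has almost all the measure of z. *)
move=> b ub; apply/le_of_diff/small => i.
have := mu_split z (x i); rewrite (meet_idPr (xz i)).
suff : mu (z `&` ~` b)%O <= mu (z `&` ~` x i)%O by move: zs; lra.
by apply/measure_le/leI2 => //; rewrite leC; exact: Tx.
Qed.

End Completeness.

(** * The measure algebra of the wide limit *)

Section MeasureAlgebra.
Variables (M : true_model) (n : M) (nN : nonstandard n) (G : wide_seq).
Variable R : realType.
Implicit Types (A B : calA n G) (x y : calB nN G).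

Let le (x y : nat) := (x <= y)%N.
Let m (x s : nat) := x \in fset_decode s.
Let cd (s : nat) := #|` fset_decode s|%fset.

Lemma toB_meet A B : (toB nN A `&` toB nN B)%O = toB nN (aI A B).
Proof. exact: meetB_toB. Qed.

Lemma toB_join A B : (toB nN A `|` toB nN B)%O = toB nN (aU A B).
Proof. exact: joinB_toB. Qed.

Lemma toB_compl A : (~` toB nN A)%O = toB nN (aC A).
Proof. exact: complB_toB. Qed.

Lemma mu_ge0 x : 0 <= mu R x.
Proof. by have := st_ge_ratio nN R (ratio_ge0 (repr x) 0); rewrite mul0r. Qed.

Lemma mu_le1 x : mu R x <= 1.
Proof. by have := st_le_ratio nN R (ratio_le1 (repr x) 0); rewrite divr1. Qed.

Lemma mu_split x y : mu R x = mu R (x `&` y)%O + mu R (x `&` ~` y)%O.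
Proof.
rewrite -(toB_repr x) -(toB_repr y) toB_compl !toB_meet !mu_toB.
exact: st_split.
Qed.

Lemma mu_pos x : mu R x = 0 -> x = \bot%O.
Proof.
move=> x0; rewrite -(toB_repr x); apply: toB_eq.
have: negligible nN (repr x) by apply: (@st_eq0_negligible _ _ _ _ R); rewrite -/(mu R x) x0.
by apply: negligible_sub => w /= [[]|[[]]].
Qed.

Definition sub_code (s t : nat) : Prop := (fset_decode s `<=` fset_decode t)%fset.

Lemma sub_codeM (a b z : M) : rel2 sub_code a b -> memM z a -> memM z b.
Proof.
have := @transfer M 3 (Imp (Rel2 sub_code (X 0) (X 1))
  (Imp (Rel2 m (X 2) (X 0)) (Rel2 m (X 2) (X 1)))) _ (tnth [tuple a; b; z]).
rewrite !satE; apply => v; rewrite !satE /m => /fsubsetP; exact.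
Qed.

(** Inclusion of codes is the value in M of a relation on the natural numbers,
    while the hypothesis is about elements of M; a function symbol naming an
    element of the difference connects the two without quantifiers. *)
Lemma sub_codeI (a b : M) : (forall z, memM z a -> memM z b) -> rel2 sub_code a b.
Proof.
move=> h.
have := @transfer M 2 (Imp
  (Imp (Rel2 m (App2 wit_code (X 0) (X 1)) (X 0))
       (Rel2 m (App2 wit_code (X 0) (X 1)) (X 1)))
  (Rel2 sub_code (X 0) (X 1))) _ (tnth [tuple a; b]).
rewrite !satE => H; apply: H; last exact: h.
move=> v; rewrite !satE /m /wit_code /sub_code.
set A := fset_decode _; set B := fset_decode _ => {}h.
rewrite -fsetD_eq0; apply/eqP/fsetP => y; rewrite in_fset0; apply/negP => yD.
have : (head 0%N (A `\` B)%fset \in A `\` B)%fset.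
  have : y \in enum_fset (A `\` B)%fset by [].
  rewrite (_ : (head 0%N (A `\` B)%fset \in (A `\` B)%fset) =
    (head 0%N (enum_fset (A `\` B)%fset) \in enum_fset (A `\` B)%fset)) //.
  by case: (enum_fset _) => // u r _; rewrite mem_head.
by rewrite in_fsetD => /andP[/negP hB hA]; exact/hB/h.
Qed.

Hypothesis Msat : aleph1_saturated M.

(** x_0 and x_1 are the parameters, x_2 is the set looked for: it includes x_0 and
    has at most j / (k + 1) times as many elements as x_1. *)
Definition cover_form (j k : nat) : Defs.form 3 :=
  And (Rel2 sub_code (X 0) (X 2))
    (Rel2 le (App2 muln (App1 cd (X 2)) (Cst 3 k.+1))
      (App2 muln (Cst 3 j) (App1 cd (X 1)))).

Definition cover_pform (b : M) (j k : nat) : pform M :=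
  @PForm M 2 (cover_form j k) (tnth [tuple b; Gn n G]).

Lemma psat_cover b j k z : psat (cover_pform b j k) z <->
  rel2 sub_code b z /\
  leM (mulM (cardM z) (std M k.+1)) (mulM (std M j) (cardM (Gn n G))).
Proof.
change (sat (cover_form j k) (vext (tnth [tuple b; Gn n G]) z) <->
  rel2 sub_code b z /\
  leM (mulM (cardM z) (std M k.+1)) (mulM (std M j) (cardM (Gn n G)))).
have -> : vext (tnth [tuple b; Gn n G]) z = tnth [tuple b; Gn n G; z].
  apply: funext => i; rewrite /vext; case: unliftP => [h|] ->.
    by case: h => -[|[|]] //= lt_h; rewrite !(tnth_nth z) /= /bump.
  by rewrite !(tnth_nth z).
by rewrite /cover_form !satE.
Qed.

Lemma coded_of_code (z : M) : coded [set w : GnT n G | memM (sval w) z].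
Proof. exact: (@coded_compr _ _ _ _ m z). Qed.

(** Saturation, for the type asking a set to include all the representatives
    [B i] and to be no larger than each rational multiple of G_n with factor
    above s. *)
Lemma mu_chain (x : nat -> calB nN G) (s : R) :
  (forall i, x i <= x i.+1)%O -> (forall i, mu R (x i) <= s) ->
  exists z, (forall i, x i <= z)%O /\ mu R z <= s.
Proof.
move=> xS xs.
have s0 : 0 <= s := le_trans (mu_ge0 _) (xs 0%N).
(* Cumulative unions, so that the inclusions are exact and not only modulo
   negligible sets. *)
pose B := fix B i : calA n G := if i is i'.+1 then aU (B i') (repr (x i)) else repr (x 0%N).
have BE i : toB nN (B i) = x i.
  elim: i => [|i IH] /=; first exact: toB_repr.
  by rewrite -toB_join IH toB_repr; apply/join_idPr.
have BB i j : (i <= j)%N -> aset (B i) `<=` aset (B j).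
  move=> /subnK <-; elim: (j - i)%N => // k IH w /IH; by left.
pose Gamma := [set psi | exists i j k, s < j%:R / k.+1%:R /\
  psi = cover_pform (acode (B i)) j k].
pose prm i := if i is i'.+1 then acode (B i') else Gn n G.
have [|||z hz] := Msat (A := range prm) (Gamma := Gamma).
- exact: sub_countable (card_image_le _ _) (countableP _).
- move=> _ [i [j [k [_ ->]]]] h /=; case: h => -[|[|]] //= lt_h.
    by rewrite (tnth_nth (Gn n G)) /=; exists i.+1.
  by rewrite (tnth_nth (Gn n G)) /=; exists 0%N.
- move=> D DG finD.
  have [f hf] : exists f : pform M -> nat, forall psi, Gamma psi ->
      exists j k, s < j%:R / k.+1%:R /\
      psi = cover_pform (acode (B (f psi))) j k.
    have /choice[f hf] : forall psi, exists i, Gamma psi ->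
      exists j k, s < j%:R / k.+1%:R /\ psi = cover_pform (acode (B i)) j k.
      move=> psi; case: (pselect (Gamma psi)) => [[i h]|h]; first by exists i.
      by exists 0%N.
    by exists f.
  have [N hN] : exists N, forall psi, D psi -> (f psi <= N)%N.
    have /finite_seqP[r hr] := finite_image f finD.
    exists (\max_(i <- r) i)%N => psi Dpsi.
    have : (f @` D) (f psi) by exists psi.
    by rewrite hr /= => fr; rewrite (big_rem _ fr) /= leq_maxl.
  (* One late representative realizes the finite part D. *)
  exists (acode (B N)) => psi Dpsi.
  have [j [k [sjk ->]]] := hf _ (DG _ Dpsi).
  apply/psat_cover; split.
    apply: sub_codeI => z /mem_acode[w Bw ->]; apply/mem_acode; exists w => //.
    exact: (BB _ _ (hN _ Dpsi)).
  apply: (@ratio_le_of_st_lt _ _ nN G R (B N)).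
  by rewrite -mu_toB BE; apply: le_lt_trans (xs N) sjk.
(* The saturated set z may contain elements that are not graphs of G_n. *)
pose Z := CalA (coded_of_code z).
have ZP j k : s < j%:R / k.+1%:R -> mu R (toB nN Z) <= j%:R / k.+1%:R.
  move=> sjk; rewrite mu_toB; apply: st_le_ratio.
  have /psat_cover[_ h] : psat (cover_pform (acode (B 0%N)) j k) z.
    by apply: hz; exists 0%N, j, k.
  have hc : leM (acard Z) (cardM z).
    by apply: le_cardM => y /mem_acode[w zw ->].
  have := @transfer M 3 (Imp (Rel2 le (X 0) (X 1)) (Imp
    (Rel2 le (App2 muln (X 1) (Cst 3 k.+1)) (App2 muln (Cst 3 j) (X 2)))
    (Rel2 le (App2 muln (X 0) (Cst 3 k.+1)) (App2 muln (Cst 3 j) (X 2))))) _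
    (tnth [tuple acard Z; cardM z; cardM (Gn n G)]).
  rewrite !satE; apply; [|exact: hc|exact: h].
  move=> v; rewrite !satE /le => h1; apply: leq_trans.
  by rewrite leq_mul2r h1 orbT.
exists (toB nN Z); split.
  have s1 : s < s + 1 by rewrite ltrDl.
  have [j [k /andP[sjk _]]] := exists_ratio_between s0 s1.
  move=> i; rewrite -BE; apply/toB_le; apply: negligible_sub (negligible0 nN G).
  have /psat_cover[sub _] : psat (cover_pform (acode (B i)) j k) z.
    by apply: hz; exists i, j, k.
  move=> w [Bw nZ]; apply: nZ; apply: sub_codeM sub _.
  by apply/mem_acode; exists w.
rewrite leNgt; apply/negP => /(exists_ratio_between s0)[j [k /andP[h1 h2]]].
by have := ZP _ _ h1; rewrite leNgt h2.
Qed.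

Lemma calB_complete (S : set (calB nN G)) : supremums S !=set0.
Proof.
exact: (@complete_of_measure _ (calB nN G) R (mu R) mu_ge0 mu_split mu_pos mu_chain).
Qed.

(** By completeness each [supremum] is a genuine join, not the default value, so
    it is above the instances. *)
Lemma le_wtruth_gexs (F : rv_family n G) l (phi : gform l) (v : 'I_l -> U F) :
  (wtruth nN phi v <= wide_limit nN F (gexs phi))%O.
Proof.
elim: l phi v => [|l IH] phi v.
  by rewrite /wide_limit (_ : v = @vnil _) //; apply: funext => -[].
apply: le_trans (IH (GEx phi) (fun i => v (lift ord_max i))) => /=.
set S := (X in supremum _ X); have Sv : S (wtruth nN phi v).
  by exists (v ord_max) => //; rewrite vext_restr.
rewrite /supremum; case: ifPn => [/eqP S0|_]; first by rewrite S0 in Sv.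
by case: xgetP => [y _ [ub _]|none]; [exact: ub|have [y /none] := calB_complete S].
Qed.

End MeasureAlgebra.

(** * Truth at constant vertices *)

(** Satisfaction of open formulas expressed on codes: unlike [gsat] its arguments
    are plain numbers, so for fixed vertex functions it gives a relation symbol of
    the language.  The value at quantifiers is arbitrary. *)
Fixpoint bsat l (phi : gform l) (s : nat) (v : 'I_l -> nat) : bool :=
  match phi with
  | GEq i j => v i == v j
  | GE i j => pair_code (v i) (v j) \in fset_decode s
  | GNeg a => ~~ bsat a s v
  | GAnd a b => bsat a s v && bsat b s v
  | GOr a b => bsat a s v || bsat b s v
  | GEx _ | GAll _ => false
  end.

Lemma bsat_graph_code k (w : {set 'I_k * 'I_k}) l (phi : gform l)
    (a : 'I_l -> 'I_k) :
  gopen phi -> bsat phi (graph_code w) (fun i => a i) = gsat w phi a.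
Proof.
elim: phi a => //= [{}l i j a _|{}l q IH a op|{}l q IHq r IHr a|{}l q IHq r IHr a].
- exact: mem_graph_code.
- by rewrite IH.
- by case/andP=> oq or; rewrite IHq ?IHr.
- by case/andP=> oq or; rewrite IHq ?IHr.
Qed.

Section ConstantVertices.
Variables (M : true_model) (n : M) (nN : nonstandard n) (G : wide_seq).
Variable F : rv_family n G.

Let m (x s : nat) := x \in fset_decode s.
Let le (x y : nat) := (x <= y)%N.
Let lt (x y : nat) := (x < y)%N.
Let cd (s : nat) := #|` fset_decode s|%fset.

Definition sat_at l (f : 'I_l -> nat -> nat) (phi : gform l) (s k : nat) : Prop :=
  bsat phi s (fun i => f i k).

(** For constant vertices named by function symbols f_i, the representative of the
    truth value of an open formula is an internal set, defined in M by the
    relation [sat_at f phi]: connectives commute with transfer, quantifiers would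
    not. *)
Lemma wtruth_const l (phi : gform l) (f : 'I_l -> nat -> nat) (v : 'I_l -> U F) :
  gopen phi -> (forall i w, sval (v i) w = Defs.fun1 (f i) n) ->
  exists A : calA n G, wtruth nN phi v = toB nN A /\
    forall w, aset A w <-> rel2 (sat_at f phi) (sval w) n.
Proof.
elim: phi f v => [{}l i j|{}l i j|{}l p IH|{}l p IHp q IHq|{}l p IHp q IHq|//|//] f v /=.
- move=> _ vE; exists (eqU (v i) (v j)); split=> // w /=; rewrite !vE.
  have := @transfer M 2 (And
    (Imp (Eq (App1 (f i) (X 1)) (App1 (f j) (X 1)))
      (Rel2 (sat_at f (GEq i j)) (X 0) (X 1)))
    (Imp (Rel2 (sat_at f (GEq i j)) (X 0) (X 1))
      (Eq (App1 (f i) (X 1)) (App1 (f j) (X 1))))) _ (tnth [tuple sval w; n]).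
  by rewrite !satE; apply=> u; rewrite !satE /sat_at /=; split=> /eqP.
- move=> _ vE; exists (EdgeU (v i) (v j)); split=> // w /=; rewrite /Edge !vE.
  pose ed := Rel2 m (App2 pair_code (App1 (f i) (X 1)) (App1 (f j) (X 1))) (@X 1 0).
  have := @transfer M 2 (And
    (Imp ed (Rel2 (sat_at f (GE i j)) (X 0) (X 1)))
    (Imp (Rel2 (sat_at f (GE i j)) (X 0) (X 1)) ed)) _ (tnth [tuple sval w; n]).
  by rewrite /ed !satE; apply=> u; rewrite !satE.
- move=> op vE; have [A [-> hA]] := IH f v op vE.
  exists (aC A); split=> [|w /=]; first exact: toB_compl.
  rewrite hA.
  have := @transfer M 2 (And
    (Imp (Neg (Rel2 (sat_at f p) (X 0) (X 1))) (Rel2 (sat_at f (GNeg p)) (X 0) (X 1)))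
    (Imp (Rel2 (sat_at f (GNeg p)) (X 0) (X 1)) (Neg (Rel2 (sat_at f p) (X 0) (X 1))))) _
    (tnth [tuple sval w; n]).
  by rewrite !satE; apply=> u; rewrite !satE /sat_at /=; split=> /negP.
- move=> /andP[op oq] vE.
  have [A [-> hA]] := IHp f v op vE; have [B [-> hB]] := IHq f v oq vE.
  exists (aI A B); split=> [|w /=]; first exact: toB_meet.
  rewrite hA hB.
  have := @transfer M 2 (And
    (Imp (And (Rel2 (sat_at f p) (X 0) (X 1)) (Rel2 (sat_at f q) (X 0) (X 1)))
      (Rel2 (sat_at f (GAnd p q)) (X 0) (X 1)))
    (Imp (Rel2 (sat_at f (GAnd p q)) (X 0) (X 1))
      (And (Rel2 (sat_at f p) (X 0) (X 1)) (Rel2 (sat_at f q) (X 0) (X 1))))) _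
    (tnth [tuple sval w; n]).
  by rewrite !satE; apply=> u; rewrite !satE /sat_at /=; split=> /andP.
- move=> /andP[op oq] vE.
  have [A [-> hA]] := IHp f v op vE; have [B [-> hB]] := IHq f v oq vE.
  exists (aU A B); split=> [|w /=]; first exact: toB_join.
  rewrite hA hB.
  have := @transfer M 2 (And
    (Imp (Or (Rel2 (sat_at f p) (X 0) (X 1)) (Rel2 (sat_at f q) (X 0) (X 1)))
      (Rel2 (sat_at f (GOr p q)) (X 0) (X 1)))
    (Imp (Rel2 (sat_at f (GOr p q)) (X 0) (X 1))
      (Or (Rel2 (sat_at f p) (X 0) (X 1)) (Rel2 (sat_at f q) (X 0) (X 1))))) _
    (tnth [tuple sval w; n]).
  by rewrite !satE; apply=> u; rewrite !satE /sat_at /=; split=> /orP.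
Qed.

Definition sat_set l (f : 'I_l -> nat -> nat) (phi : gform l) (k : nat) : nat :=
  fset_code [fset s in [seq s <- [seq graph_code w | w <- enum (G k)] |
    bsat phi s (fun i => f i k)]]%fset.

Lemma card_sat_set l (f : 'I_l -> nat -> nat) (phi : gform l) k (a : 'I_l -> 'I_k) :
  gopen phi -> (forall i, f i k = a i) ->
  #|` fset_decode (sat_set f phi k)|%fset = #|[set w in G k | gsat w phi a]|.
Proof.
move=> op fa; rewrite fset_codeK card_fseq undup_id; last first.
  by rewrite filter_uniq // map_inj_uniq ?enum_uniq //; exact: graph_code_inj.
rewrite size_filter count_map.
have -> : (fun i => f i k) = (fun i => nat_of_ord (a i)) by apply: funext.
rewrite (@eq_count _ _ (fun w => gsat w phi a)); last first.
  by move=> w /=; rewrite bsat_graph_code.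
rewrite cardE -size_filter; apply/perm_size/uniq_perm.
- by rewrite filter_uniq ?enum_uniq.
- exact: enum_uniq.
- by move=> w; rewrite mem_filter !mem_enum inE andbC.
Qed.

Hypothesis Fconst : forall c : M, rv F (fun _ => c).

(** The witnesses a may depend on k in any way: every function on the natural
    numbers has a name in the language, so their value at n is defined. *)
Lemma ratio_le_mu_gexs (R : realType) (Msat : aleph1_saturated M)
    l (phi : gform l) (i d : nat) : gopen phi ->
  (\forall k \near \oo, exists a : 'I_l -> 'I_k,
    (i * #|G k| <= #|[set w in G k | gsat w phi a]| * d.+1)%N) ->
  i%:R / d.+1%:R <= mu R (wide_limit nN F (gexs phi)).
Proof.
move=> op [K _ hK].
(* Vertices as numbers; below K they are arbitrary, which the nonstandard n does
   not see. *)
have /choice[a ha] : forall k, exists a : 'I_l -> nat, (K <= k)%N ->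
    exists2 b : 'I_l -> 'I_k, (forall j, a j = b j) &
      (i * #|G k| <= #|[set w in G k | gsat w phi b]| * d.+1)%N.
  move=> k; case: (leqP K k) => [/hK[b hb]|_]; last by exists (fun _ => 0%N).
  by exists (fun j => nat_of_ord (b j)) => _; exists b.
pose f j k := a k j.
have Kn := nonstandard_ge nN K.
have fn j : ltM (Defs.fun1 (f j) n) n.
  have := @transfer M 1 (Imp (Rel2 le (Cst 1 K) (X 0))
    (Rel2 lt (App1 (f j) (X 0)) (X 0))) _ (tnth [tuple n]).
  rewrite !satE; apply=> // u; rewrite !satE /le /lt /f => /ha[b -> _].
  exact: ltn_ord.
pose v j : U F := exist _ (fun _ => Defs.fun1 (f j) n) (conj (Fconst _) (fun _ => fn j)).
have [A [vA hA]] := @wtruth_const l phi f v op (fun _ _ => erefl).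
apply: (@le_trans _ _ (mu R (wtruth nN phi v))); last first.
  apply: (measure_le (mu := mu R)); [exact: mu_ge0|exact: mu_split|].
  exact: le_wtruth_gexs.
rewrite vA mu_toB; apply: st_ge_ratio.
have cA : leM (cardM (Defs.fun1 (sat_set f phi) n)) (acard A).
  apply: le_cardM => x xs; apply/mem_acode.
  have := @transfer M 2 (Imp (Rel2 m (X 0) (App1 (sat_set f phi) (X 1)))
    (And (Rel2 m (X 0) (App1 (gset_code G) (X 1)))
      (Rel2 (sat_at f phi) (X 0) (X 1)))) _ (tnth [tuple x; n]).
  rewrite !satE => H; case: H => // [u|xG xf].
    rewrite !satE /m /sat_set /gset_code /sat_at !fset_codeK !in_fset /=.
    by rewrite mem_filter => /andP[].
  by exists (exist _ x xG) => //; apply/hA.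
have := @transfer M 2 (Imp (Rel2 le (Cst 2 K) (X 1)) (Imp
  (Rel2 le (App1 cd (App1 (sat_set f phi) (X 1))) (X 0))
  (Rel2 le (App2 muln (Cst 2 i) (App1 cd (App1 (gset_code G) (X 1))))
    (App2 muln (X 0) (Cst 2 d.+1))))) _ (tnth [tuple acard A; n]).
rewrite !satE; apply; [|exact: Kn|exact: cA].
move=> u; rewrite !satE /le /cd card_gset_code => /ha[b fb hb].
rewrite (card_sat_set op fb) => h; apply: leq_trans hb _.
by rewrite leq_mul2r h orbT.
Qed.

End ConstantVertices.

(** * Averaging over vertices *)

(** Exchanging the order of summation: otherwise the strict converse inequalities
    at every a would sum to the converse of the hypothesis. *)
Lemma exists_le_average (T I : finType) (D : pred T) (P : T -> I -> bool)
    (i d : nat) :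
  (i * #|[pred u : T * I | D u.1]| < d * #|[pred u : T * I | D u.1 && P u.1 u.2]|)%N ->
  exists a, (i * #|[pred t | D t]| <= #|[pred t | D t && P t a]| * d)%N.
Proof.
move=> h; apply: contrapT => /forallNP none; move: h; apply/negP; rewrite -leqNgt.
have -> : #|[pred u : T * I | D u.1]| = (\sum_(a : I) #|[pred t | D t]|)%N.
  rewrite sum_nat_const mulnC -cardX.
  by apply: eq_card => -[t a]; rewrite !inE andbT.
have -> : #|[pred u : T * I | D u.1 && P u.1 u.2]| =
    (\sum_(a : I) #|[pred t | D t && P t a]|)%N.
  rewrite -sum1_card (eq_bigr (fun a => \sum_(t | D t && P t a) 1)%N).
    rewrite (exchange_big_dep D) /=; last by move=> a t _ /andP[].
    rewrite pair_big_dep; apply: eq_bigl => -[t a] /=.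
    by rewrite unfold_in /=; case: (D t).
  by move=> a _; rewrite sum1_card.
rewrite !big_distrr /=; apply: leq_sum => a _.
by have /negP := none a; rewrite -ltnNge mulnC => /ltnW.
Qed.

Theorem theorem3p11 (R : realType) (M : true_model)
  (Msat : aleph1_saturated M) (n : M) (nN : nonstandard n)
  (G : wide_seq) (F : rv_family n G)
  (Fconst : forall c : M, rv F (fun _ => c))
  (l : nat) (phi : gform l) (phi_open : gopen phi)
  (p : R) (p01 : 0 <= p <= 1)
  (prob_cvg : cvgn (prob_sat R G phi))
  (prob_ge : p <= limn (prob_sat R G phi)) :
  p <= mu R (wide_limit nN F (gexs phi)) /\
  (p = 1 -> wide_limit nN F (gexs phi) = \top%O).
Proof.
set x := wide_limit _ _ _.
have px : p <= mu R x.
  rewrite leNgt; apply/negP => /(exists_ratio_between (mu_ge0 _ _)).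
  case=> i [d /andP[h1 h2]]; move: h1; apply/negP; rewrite -leNgt.
  apply: ratio_le_mu_gexs => //.
  have := cvgr_gt _ prob_cvg _ (lt_le_trans h2 prob_ge).
  move=> hlim; apply: filterS (hlim _) => k.
  rewrite /prob_sat /unif_prob.
  set N := #|_|; set D := #|_| => hND.
  have [a ha] : exists a : {ffun 'I_l -> 'I_k},
      (i * #|[pred w | w \in G k]| <=
       #|[pred w | (w \in G k) && gsat w phi a]| * d.+1)%N.
    apply: (@exists_le_average _ _ (mem (G k))
      (fun w (a : {ffun 'I_l -> 'I_k}) => gsat w phi a)).
    (* With no pairs to sample the quotient is 0 and cannot exceed i / (d + 1). *)
    have D0 : (0 < D)%N.
      rewrite lt0n; apply/eqP => D0; move: hND.
      by rewrite D0 invr0 mulr0 ltNge divr_ge0.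
    move: hND; rewrite ltr_pdivrMr ?ltr0n // mulrAC ltr_pdivlMr ?ltr0n //.
    by rewrite -!natrM ltr_nat mulnC [X in (_ < X)%N]mulnC.
  exists a; rewrite (_ : #|[set w in G k | _]| =
    #|[pred w | (w \in G k) && gsat w phi a]|) //.
  by apply: eq_card => w; rewrite !inE.
split=> // p1.
have c0 : mu R (~` x)%O = 0.
  have := mu_split R \top%O x; rewrite !meet1x.
  have := mu_le1 R (\top%O : calB nN G); have := mu_ge0 R (~` x)%O.
  by move: px; rewrite p1; lra.
by rewrite -[x]complK (mu_pos c0) compl0.
Qed.
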